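(* Let $G$ be a goal for a $\mathrm{QCLP}(\mathcal{D},\mathcal{C})$-program $\mathcal{P}$ such that $\mathit{qVal}$ and $\mathit{qBound}$ do not occur in $\mathcal{P}$ or $G$. Let $\mathcal{P}'=\mathrm{elim}_{\mathcal{D}}(\mathcal{P})$ and $G'=\mathrm{elim}_{\mathcal{D}}(G)$. Assume a $\mathcal{C}$-substitution $\sigma$, a mapping $\mu:\mathrm{war}(G)\to D\setminus\{\bot\}$ and a satisfiable finite set of $\mathcal{C}$-constraints $\Pi$. Then the following are equivalent: (1) $\langle\sigma,\mu,\Pi\rangle\in\mathrm{Sol}_{\mathcal{P}}(G)$; (2) $\langle\theta,\Pi\rangle\in\mathrm{Sol}_{\mathcal{P}'}(G')$ for some $\theta$ such that (a) $\theta=\sigma$ on $\mathrm{var}(G)$, (b) $W\theta=\imath(W\mu)$ for every $W\in\mathrm{war}(G)$, and (c) $W\theta\in\mathrm{ran}(\imath)$ for each $W\in\mathrm{var}(G')\setminus(\mathrm{var}(G)\cup\mathrm{war}(G))$.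
   Context: $\mathcal{D}=\langle D,\sqsubseteq,\bot,\top,\circ\rangle$ is a qualification domain (lattice with meet $\sqcap$; attenuation $\circ$ associative, commutative, monotonic, $d\circ\top=d$, $d\circ\bot=\bot$, $d\circ e\sqsubseteq e$, distributing over $\sqcap$) existentially expressible in the constraint domain $\mathcal{C}$ via an injective $\imath:D\setminus\{\bot\}\to C$ and existential constraints $\mathrm{qval}(X)=\exists\overline{U}(B_1\wedge\cdots\wedge B_m)$ (solutions: $X\eta\in\mathrm{ran}(\imath)$) and $\mathrm{qbound}(X,Y,Z)=\exists\overline{V}(C_1\wedge\cdots\wedge C_q)$ (for $X,Y,Z$ valued $\imath(x),\imath(y),\imath(z)$: satisfied iff $x\sqsubseteq y\circ z$). $E_{\mathcal{D}}$ is the CLP program $\mathit{qVal}(X)\gets B_1,\dots,B_m$, $\mathit{qBound}(X,Y,Z)\gets C_1,\dots,C_q$. $\mathrm{QCHL}(\mathcal{D},\mathcal{C})$ derivability: QDA: from $(t'_i==t_i\theta)\#d_i\Leftarrow\Pi$ and $B_j\theta\#e_j\Leftarrow\Pi$ infer $p(t'_1,\dots,t'_n)\#d\Leftarrow\Pi$ using a clause $p(t_1,\dots,t_n)\xleftarrow{\alpha}B_1\#w_1,\dots,B_m\#w_m$ if $e_j\sqsupseteq^?w_j$ ($\sqsupseteq$ if $w_j\ne ?$, true otherwise) and $d\sqsubseteq d_1\sqcap\cdots\sqcap d_n\sqcap\alpha\circ(e_1\sqcap\cdots\sqcap e_m)$; QEA: $(t==s)\#d\Leftarrow\Pi$ if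 $\Pi\models_{\mathcal{C}}t==s$; QPA: $\kappa\#d\Leftarrow\Pi$ if $\Pi\models_{\mathcal{C}}\kappa$. $\mathrm{CHL}(\mathcal{C})$ is the analogous system for CLP clauses $p(\overline{t})\gets B_1,\dots,B_m$ and atoms $A\Leftarrow\Pi$ (rules DA, EA, PA without qualifications). QCLP goals: $G:(B_j\#W_j,W_j\sqsupseteq^?\beta_j)_{j=1..m}$, $\mathrm{war}(G)=\{W_1,\dots,W_m\}$; $\langle\sigma,\mu,\Pi\rangle\in\mathrm{Sol}_{\mathcal{P}}(G)$ iff $W_j\mu\sqsupseteq^?\beta_j$ and $\mathcal{P}\vdash_{\mathrm{QCHL}(\mathcal{D},\mathcal{C})}B_j\sigma\#W_j\mu\Leftarrow\Pi$ for all $j$. CLP goals are atom sequences $A_1,\dots,A_k$; $\langle\theta,\Pi\rangle\in\mathrm{Sol}_{\mathcal{P}'}(G')$ iff $\Pi$ is satisfiable finite and $\mathcal{P}'\vdash_{\mathrm{CHL}(\mathcal{C})}A_i\theta\Leftarrow\Pi$ for all $i$. Transformation: each $p$ of arity $n$ becomes distinct $p'$ of arity $n+1$; $\overline{t==s}=(t==s,\imath(\top))$, $\overline{\kappa}=(\kappa,\imath(\top))$, $\overline{p(t_1,\dots,t_n)}=(p'(t_1,\dots,t_n,W),W)$ with $W$ fresh. A clause $p(t_1,\dots,t_n)\xleftarrow{\alpha}B_1\#w_1,\dots,B_m\#w_m$ with $\overline{B_j}=(B'_j,w'_j)$ becomes $p'(t_1,\dots,t_n,W)\gets\mathit{qVal}(W),(\mathit{qVal}(w'_j),[w'_j\sqsupseteq^?\imath(w_j)],\mathit{qBound}(W,\imath(\alpha),w'_j),B'_j)_{j=1..m}$,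 where $[w'\sqsupseteq^?\imath(w)]$ is omitted if $w=?$ and otherwise is $\mathit{qBound}(\imath(w),\imath(\top),w')$; $\mathrm{elim}_{\mathcal{D}}(\mathcal{P})$ is $E_{\mathcal{D}}$ plus the transformed clauses. The goal $G$ becomes $\mathrm{elim}_{\mathcal{D}}(G)=(\mathit{qVal}(W_j),[W_j\sqsupseteq^?\imath(\beta_j)],\mathit{qVal}(w'_j),\mathit{qBound}(W_j,\imath(\top),w'_j),B'_j)_{j=1..m}$, where the $W_j$ become ordinary CLP variables.
   Formalization: Clauses with empty body (m = 0) are required to have attenuation α = ⊤: the transformed fact p'(t,W) ← qVal(W) loses α, so for a fact p with α ≠ ⊤, goal p#W and μ(W) = ⊤, (2) holds while (1) fails. *)

(* Defs.v *)
From HB Require Import structures.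
From mathcomp Require Import all_boot all_order.

Set Implicit Arguments.
Unset Strict Implicit.
Unset Printing Implicit Defensive.

Import Order.TTheory.
Local Open Scope order_scope.

Record signature := Signature {
  dcons : nat -> Type;
  pprim : nat -> Type;
  dpred : nat -> Type }.

Inductive term (S : signature) (B V : Type) : Type :=
  | TVar of V
  | TVal of B
  | TApp (n : nat) of dcons S n & {ffun 'I_n -> term S B V}.

Arguments TVar {S B V} x.
Arguments TVal {S B V} b.
Arguments TApp {S B V n} c ts.

Fixpoint bind (S : signature) (B U V : Type)
    (s : U -> term S B V) (t : term S B U) : term S B V :=
  match t with
  | TVar x => s x
  | TVal b => TVal b
  | TApp n c ts => TApp c [ffun i => bind s (ts i)]
  end.

Fixpoint tvars (S : signature) (B V : Type) (t : term S B V) : seq V :=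
  match t with
  | TVar x => [:: x]
  | TVal _ => [::]
  | TApp n c ts => flatten [seq tvars (ts i) | i <- enum 'I_n]
  end.

(* The carrier is the set of ground terms over the basic values. *)
Record cdomain (S : signature) := CDomain {
  bval : Type;
  pint : forall n, pprim S n -> n.-tuple (term S bval void) -> Prop }.

Section Constraints.

Variables (S : signature) (C : cdomain S) (V : eqType).

Definition cterm := term S (bval C) V.
Definition value := term S (bval C) void.
Definition csubst := V -> cterm.
Definition valuation := V -> value.

Definition of_value (v : value) : cterm :=
  bind (fun x : void => match x with end) v.

Inductive aconstr :=
  | CEq of cterm & cterm
  | CPrim (n : nat) of pprim S n & n.-tuple cterm.

Definition asubst (s : csubst) (k : aconstr) : aconstr :=
  match k with
  | CEq t u => CEq (bind s t) (bind s u)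
  | CPrim n r ts => CPrim r (map_tuple (bind s) ts)
  end.

Definition avars (k : aconstr) : seq V :=
  match k with
  | CEq t u => tvars t ++ tvars u
  | CPrim n r ts => flatten [seq tvars t | t <- ts]
  end.

Definition asat (eta : valuation) (k : aconstr) : Prop :=
  match k with
  | CEq t u => bind eta t = bind eta u
  | CPrim n r ts => pint r (map_tuple (bind eta) ts)
  end.

(* C-constraints: first-order formulas (the remaining connectives and the
   universal quantifier are classically definable). *)
Inductive constr :=
  | CAtom of aconstr
  | CTrue
  | CAnd of constr & constr
  | CNot of constr
  | CEx of V & constr.

Fixpoint sat (eta : valuation) (k : constr) : Prop :=
  match k with
  | CAtom a => asat eta a
  | CTrue => True
  | CAnd k1 k2 => sat eta k1 /\ sat eta k2
  | CNot k1 => ~ sat eta k1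
  | CEx x k1 => exists v : value, sat (fun y => if y == x then v else eta y) k1
  end.

Definition exconstr (us : seq V) (bs : seq aconstr) : constr :=
  foldr CEx (foldr CAnd CTrue [seq CAtom b | b <- bs]) us.

Fixpoint sat_all (eta : valuation) (Pi : seq constr) : Prop :=
  if Pi is k :: Pi' then sat eta k /\ sat_all eta Pi' else True.

Definition satisfiable (Pi : seq constr) : Prop :=
  exists eta : valuation, sat_all eta Pi.

Definition entails (Pi : seq constr) (k : aconstr) : Prop :=
  forall eta : valuation, sat_all eta Pi -> sat eta (CAtom k).

Inductive atom :=
  | ADef (n : nat) of dpred S n & n.-tuple cterm
  | ACon of aconstr.

Definition atsubst (s : csubst) (A : atom) : atom :=
  match A with
  | ADef n p ts => ADef p (map_tuple (bind s) ts)
  | ACon k => ACon (asubst s k)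
  end.

Definition atvars (A : atom) : seq V :=
  match A with
  | ADef n p ts => flatten [seq tvars t | t <- ts]
  | ACon k => avars k
  end.

Definition pred_occurs (n : nat) (q : dpred S n) (A : atom) : Prop :=
  if A is ADef m p _
  then existT (dpred S) m p = existT (dpred S) n q
  else False.

End Constraints.

Arguments CEq {S C V} t u.
Arguments CPrim {S C V n} r ts.
Arguments CTrue {S C V}.
Arguments ADef {S C V n} p ts.
Arguments ACon {S C V} k.

Record qualification (disp : Order.disp_t) (D : tbLatticeType disp) :=
  Qualification {
    att : D -> D -> D;
    bot_neq_top : \bot != \top :> D;
    attA : associative att;
    attC : commutative att;
    att_mono : forall d d' e e', d <= d' -> e <= e' -> att d e <= att d' e';
    att_top : forall d, att d \top = d;
    att_bot : forall d, att d \bot = \bot;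
    att_le : forall d e, att d e <= e;
    att_meet : forall d e1 e2, att d (e1 `&` e2) = att d e1 `&` att d e2 }.

Definition nonbot (disp : Order.disp_t) (D : tbLatticeType disp) :=
  {d : D | d != \bot}.

Lemma top_nonbot (disp : Order.disp_t) (D : tbLatticeType disp)
  (Q : qualification D) : \top != \bot :> D.
Proof. by rewrite eq_sym; exact: bot_neq_top Q. Qed.

Definition qtop (disp : Order.disp_t) (D : tbLatticeType disp)
    (Q : qualification D) : nonbot D :=
  exist _ \top (top_nonbot Q).

(* [None] is the threshold [?]. *)
Definition threshold (disp : Order.disp_t) (D : tbLatticeType disp) :=
  option (nonbot D).

Definition above (disp : Order.disp_t) (D : tbLatticeType disp)
    (e : nonbot D) (w : threshold D) : bool :=
  if w is Some w0 then val w0 <= val e else true.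

(* Existential expressibility of D in C: qval(qvX) is
   exists qvU (/\ qvB), and qbound(qbX, qbY, qbZ) is exists qbV (/\ qbC). *)
Record expressible (S : signature) (C : cdomain S) (V : eqType)
    (disp : Order.disp_t) (D : tbLatticeType disp) (Q : qualification D) :=
  Expressible {
    emb : nonbot D -> value C;
    emb_inj : injective emb;
    qvX : V;
    qvU : seq V;
    qvB : seq (aconstr C V);
    qvX_notin : qvX \notin qvU;
    qvB_vars : {subset flatten [seq avars b | b <- qvB] <= qvX :: qvU};
    qvalP : forall eta : valuation C V,
          sat eta (exconstr qvU qvB) <-> exists d, eta qvX = emb d;
    qbX : V;
    qbY : V;
    qbZ : V;
    qbV : seq V;
    qbC : seq (aconstr C V);
    qb_uniq : uniq [:: qbX; qbY; qbZ];
    qb_notin : ~~ has (mem qbV) [:: qbX; qbY; qbZ];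
    qbC_vars : {subset flatten [seq avars b | b <- qbC]
           <= [:: qbX; qbY; qbZ] ++ qbV};
    qboundP : forall (eta : valuation C V) (x y z : nonbot D),
          eta qbX = emb x -> eta qbY = emb y -> eta qbZ = emb z ->
          (sat eta (exconstr qbV qbC) <-> val x <= att Q (val y) (val z)) }.

Section CLP.

Variables (S : signature) (C : cdomain S) (V : eqType).

Record clause := Clause {
  cl_ar : nat;
  cl_pred : dpred S cl_ar;
  cl_args : cl_ar.-tuple (cterm C V);
  cl_body : seq (atom C V) }.

Definition program := clause -> Prop.

Inductive chl (P : program) (Pi : seq (constr C V)) : atom C V -> Prop :=
  | DA (c : clause) (theta : csubst C V) (ts : (cl_ar c).-tuple (cterm C V)) :
      P c ->
      (forall i : 'I_(cl_ar c),
          chl P Pi (ACon (CEq (tnth ts i) (bind theta (tnth (cl_args c) i))))) ->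
      (forall j : 'I_(size (cl_body c)),
          chl P Pi (atsubst theta (tnth (in_tuple (cl_body c)) j))) ->
      chl P Pi (ADef (cl_pred c) ts)
  | EA (t s : cterm C V) :
      entails Pi (CEq t s) -> chl P Pi (ACon (CEq t s))
  | PA (n : nat) (r : pprim S n) (ts : n.-tuple (cterm C V)) :
      entails Pi (CPrim r ts) -> chl P Pi (ACon (CPrim r ts)).

Definition goal := seq (atom C V).

Definition gvars (G : goal) : seq V := flatten [seq atvars A | A <- G].

Definition Sol (P : program) (G : goal)
    (theta : csubst C V) (Pi : seq (constr C V)) : Prop :=
  satisfiable Pi /\
  forall i : 'I_(size G), chl P Pi (atsubst theta (tnth (in_tuple G) i)).

End CLP.

Section QCLP.

Variables (S : signature) (C : cdomain S) (V : eqType).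
Variables (disp : Order.disp_t) (D : tbLatticeType disp) (Q : qualification D).

Record qclause := QClause {
  qcl_ar : nat;
  qcl_pred : dpred S qcl_ar;
  qcl_args : qcl_ar.-tuple (cterm C V);
  qcl_att : nonbot D;
  qcl_body : seq (atom C V * threshold D) }.

Definition qprogram := qclause -> Prop.

Definition qcl_head (c : qclause) : atom C V := ADef (qcl_pred c) (qcl_args c).

Definition qcl_vars (c : qclause) : seq V :=
  atvars (qcl_head c) ++ flatten [seq atvars B.1 | B <- qcl_body c].

Inductive qchl (P : qprogram) (Pi : seq (constr C V)) :
    atom C V -> nonbot D -> Prop :=
  | QDA (c : qclause) (theta : csubst C V)
      (ts : (qcl_ar c).-tuple (cterm C V))
      (ds : 'I_(qcl_ar c) -> nonbot D)
      (es : 'I_(size (qcl_body c)) -> nonbot D) (d : nonbot D) :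
      P c ->
      (forall i : 'I_(qcl_ar c),
          qchl P Pi
            (ACon (CEq (tnth ts i) (bind theta (tnth (qcl_args c) i)))) (ds i)) ->
      (forall j : 'I_(size (qcl_body c)),
          qchl P Pi
            (atsubst theta (tnth (in_tuple (qcl_body c)) j).1) (es j)) ->
      (forall j : 'I_(size (qcl_body c)),
          above (es j) (tnth (in_tuple (qcl_body c)) j).2) ->
      val d <= (\meet_(i < qcl_ar c) val (ds i)) `&`
               att Q (val (qcl_att c))
                 (\meet_(j < size (qcl_body c)) val (es j)) ->
      qchl P Pi (ADef (qcl_pred c) ts) d
  | QEA (t s : cterm C V) (d : nonbot D) :
      entails Pi (CEq t s) -> qchl P Pi (ACon (CEq t s)) d
  | QPA (n : nat) (r : pprim S n) (ts : n.-tuple (cterm C V)) (d : nonbot D) :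
      entails Pi (CPrim r ts) -> qchl P Pi (ACon (CPrim r ts)) d.

(* A component B # W, W >=? beta of a goal.  Qualification variables W are
   drawn from V, so that they can be used as CLP variables after the
   transformation; [qgoal_wf] keeps them apart from the variables of the
   atoms. *)
Record qgoal_item := QGoalItem {
  qg_atom : atom C V;
  qg_war : V;
  qg_bound : threshold D }.

Definition qgoal := seq qgoal_item.

Definition qgvars (G : qgoal) : seq V := flatten [seq atvars (qg_atom g) | g <- G].

Definition war (G : qgoal) : seq V := [seq qg_war g | g <- G].

Definition qgoal_wf (G : qgoal) : bool := ~~ has (mem (qgvars G)) (war G).

Definition qSol (P : qprogram) (G : qgoal)
    (sigma : csubst C V) (mu : {x : V | x \in war G} -> nonbot D)
    (Pi : seq (constr C V)) : Prop :=
  forall (j : 'I_(size G)) (Wj : {x : V | x \in war G}),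
    val Wj = qg_war (tnth (in_tuple G) j) ->
    above (mu Wj) (qg_bound (tnth (in_tuple G) j)) /\
    qchl P Pi (atsubst sigma (qg_atom (tnth (in_tuple G) j))) (mu Wj).

Definition qprog_no_pred (n : nat) (q : dpred S n) (P : qprogram) : Prop :=
  forall c, P c ->
    ~ pred_occurs q (qcl_head c) /\
    forall j : 'I_(size (qcl_body c)),
      ~ pred_occurs q (tnth (in_tuple (qcl_body c)) j).1.

Definition qgoal_no_pred (n : nat) (q : dpred S n) (G : qgoal) : Prop :=
  forall j : 'I_(size G), ~ pred_occurs q (qg_atom (tnth (in_tuple G) j)).

End QCLP.

(* The symbols p' are pairwise distinct and distinct from qVal and qBound. *)
Record elim_preds (S : signature) := ElimPreds {
  qVal : dpred S 1;
  qBound : dpred S 3;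
  prime_of : forall n, dpred S n -> dpred S n.+1;
  prime_of_inj : forall n, injective (@prime_of n);
  prime_of_qVal : forall p, prime_of p <> qVal;
  prime_of_qBound : forall p, prime_of p <> qBound }.

(* A supply of fresh variables, i.e. a witness that V is infinite. *)
Record var_supply (V : eqType) := VarSupply {
  fresh : seq V -> V;
  fresh_notin : forall s, fresh s \notin s }.

Fixpoint freshes (V : eqType) (F : var_supply V) (n : nat) (s : seq V) : seq V :=
  if n is n'.+1 then let x := fresh F s in x :: freshes F n' (x :: s)
  else [::].

Section Elim.

Variables (S : signature) (C : cdomain S) (V : eqType).
Variables (disp : Order.disp_t) (D : tbLatticeType disp) (Q : qualification D).
Variables (X : expressible C V Q) (F : var_supply V) (N : elim_preds S).

Definition embt (d : nonbot D) : cterm C V := of_value V (emb X d).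

Definition qval_at (t : cterm C V) : atom C V := ADef (qVal N) [tuple t].

Definition qbound_at (t u v : cterm C V) : atom C V :=
  ADef (qBound N) [tuple t; u; v].

Definition E_qVal : clause C V :=
  Clause (qVal N) [tuple TVar (qvX X)] [seq ACon b | b <- qvB X].

Definition E_qBound : clause C V :=
  Clause (qBound N) [tuple TVar (qbX X); TVar (qbY X); TVar (qbZ X)]
    [seq ACon b | b <- qbC X].

Definition E_prog : program C V := fun c => c = E_qVal \/ c = E_qBound.

(* [W] is the variable to be used if [A] is a defined atom. *)
Definition elim_atom (A : atom C V) (W : V) : atom C V * cterm C V :=
  match A with
  | ADef n p ts => (ADef (prime_of N p) [tuple of rcons ts (TVar W)], TVar W)
  | ACon k => (ACon k, embt (qtop Q))
  end.

Definition elim_bound (w' : cterm C V) (w : threshold D) : seq (atom C V) :=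
  if w is Some w0 then [:: qbound_at (embt w0) (embt (qtop Q)) w'] else [::].

Definition elim_body_item (W : V) (alpha : nonbot D)
    (x : (atom C V * threshold D) * V) : seq (atom C V) :=
  let: (B, w, Wj) := x in
  let: (B', w') := elim_atom B Wj in
  qval_at w' :: elim_bound w' w ++ [:: qbound_at (TVar W) (embt alpha) w'; B'].

Definition elim_clause (c : qclause C V D) : clause C V :=
  let W := fresh F (qcl_vars c) in
  let Ws := freshes F (size (qcl_body c)) (W :: qcl_vars c) in
  Clause (prime_of N (qcl_pred c)) [tuple of rcons (qcl_args c) (TVar W)]
    (qval_at (TVar W) ::
     flatten [seq elim_body_item W (qcl_att c) x | x <- zip (qcl_body c) Ws]).

Definition elim_prog (P : qprogram C V D) : program C V :=
  fun c' => E_prog c' \/ exists2 c, P c & c' = elim_clause c.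

Definition elim_goal_item (x : qgoal_item C V D * V) : seq (atom C V) :=
  let: (g, Wj) := x in
  let: (B', w') := elim_atom (qg_atom g) Wj in
  let W := TVar (qg_war g) in
  qval_at W :: elim_bound W (qg_bound g) ++
  [:: qval_at w'; qbound_at W (embt (qtop Q)) w'; B'].

Definition elim_goal (G : qgoal C V D) : goal C V :=
  flatten [seq elim_goal_item x
          | x <- zip G (freshes F (size G) (qgvars G ++ war G))].

End Elim.

(* Main.v *)
Require Import Defs.
From HB Require Import structures.
From Stdlib Require List Eqdep_dec.
From mathcomp Require Import all_boot all_order.

Set Implicit Arguments.
Unset Strict Implicit.
Unset Printing Implicit Defensive.

Import Order.TTheory.

(** From a QCHL derivation of [A # d] one builds a CHL derivation of the
    transformed atom whose extra argument is the ground term [embt X d].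
    Conversely, the extra argument [t] of a transformed atom derived in CHL need
    not be ground, so no qualification can be read off from [t] itself.  One
    fixes a single valuation [eta] satisfying [Pi] and takes the [d] such that
    [eta] sends [t] to [emb X d]: the [qVal] atoms make it exist, the [qBound]
    atoms evaluated at [eta] give the inequalities required by QDA, and the
    remaining premises are entailments from [Pi], which do not involve [d]. *)

(** * Sequences and tuples *)

Lemma Forall_tnthP (T : Type) (R : T -> Prop) (s : seq T) :
  List.Forall R s <-> forall j : 'I_(size s), R (tnth (in_tuple s) j).
Proof.
split.
  elim=> [[]//|x s' hx _ IH] j.
  rewrite (tnth_nth x); case: j => [[|j] hj] //=.
  by have := IH (Ordinal (hj : j < size s')); rewrite (tnth_nth x).
elim: s => [|x s IH] h; first exact: List.Forall_nil.
apply: List.Forall_cons; first exact: (h ord0).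
apply: IH => j; have := h (lift ord0 j).
by rewrite !(tnth_nth x).
Qed.

Lemma Forall_cat (T : Type) (R : T -> Prop) (s1 s2 : seq T) :
  List.Forall R (s1 ++ s2) <-> List.Forall R s1 /\ List.Forall R s2.
Proof. exact: List.Forall_app. Qed.

(** Bodies of transformed clauses and transformed goals are concatenations of blocks, one for each
    original atom paired with its fresh variable. This gives access to the block of the [j]-th atom;
    the default [y0] is never read, since the sizes agree. *)
Lemma Forall_flatten_zip (I J T : Type) (R : T -> Prop) (f : I * J -> seq T)
    (y0 : J) (s : seq I) (t : seq J) : size t = size s ->
  List.Forall R (flatten [seq f x | x <- zip s t]) <->
  forall j : 'I_(size s), List.Forall R (f (tnth (in_tuple s) j, nth y0 t j)).
Proof.
move=> hst; split.
  elim: s t hst => [|x s IH] [|y t] //=; first by move=> _ _ [].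
  move=> [hst] /Forall_cat [h1 h2] j.
  rewrite (tnth_nth x); case: j => [[|j] hj] //=.
  by have := IH _ hst h2 (Ordinal (hj : j < size s)); rewrite (tnth_nth x).
elim: s t hst => [|x s IH] [|y t] //=.
move=> [hst] h; apply/Forall_cat; split; first exact: (h ord0).
apply: IH => // j.
by have := h (lift ord0 j); rewrite !(tnth_nth x).
Qed.

Lemma tnth_rcons_ord_max (T : Type) (n : nat) (ts : n.-tuple T) (t : T) :
  tnth [tuple of rcons ts t] ord_max = t.
Proof. by rewrite (tnth_nth t) /= nth_rcons size_tuple ltnn eqxx. Qed.

Lemma tnth_rcons_widen (T : Type) (n : nat) (ts : n.-tuple T) (t : T)
    (i : 'I_n) :
  tnth [tuple of rcons ts t] (widen_ord (leqnSn n) i) = tnth ts i.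
Proof. by rewrite !(tnth_nth t) /= nth_rcons size_tuple ltn_ord. Qed.

Lemma tnth_rconsP (T : Type) (n : nat) (R : T -> T -> Prop)
    (ts us : n.-tuple T) (t u : T) :
  (forall i, R (tnth ts i) (tnth us i)) -> R t u ->
  forall i, R (tnth [tuple of rcons ts t] i) (tnth [tuple of rcons us u] i).
Proof.
move=> h htu i; case: (unliftP ord_max i) => [j ->|->]; last first.
  by rewrite !tnth_rcons_ord_max.
suff -> : lift ord_max j = widen_ord (leqnSn n) j by rewrite !tnth_rcons_widen.
by apply: val_inj; rewrite /= /bump leqNgt ltn_ord.
Qed.

Lemma map_tuple_rcons (T U : Type) (f : T -> U) (n : nat) (ts : n.-tuple T)
    (t : T) :
  map_tuple f [tuple of rcons ts t] =
  [tuple of rcons (map_tuple f ts) (f t)].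
Proof. by apply: val_inj; rewrite /= map_rcons. Qed.

(** Predicate symbols and argument tuples are indexed by the arity, so injectivity of [ADef] yields
    only equalities of dependent pairs. Decidable equality on [nat] makes these usable without an
    axiom. *)
Lemma existT_nat_inj (T : nat -> Type) (n : nat) (x y : T n) :
  existT T n x = existT T n y -> x = y.
Proof. exact: (Eqdep_dec.inj_pair2_eq_dec _ PeanoNat.Nat.eq_dec). Qed.

(** * Fresh variables *)

Section FreshVariables.

Variables (V : eqType) (F : var_supply V).

Lemma size_freshes (n : nat) (s : seq V) : size (freshes F n s) = n.
Proof. by elim: n s => //= n IH s; rewrite IH. Qed.

Lemma freshes_notin (n : nat) (s : seq V) (x : V) :
  x \in freshes F n s -> x \notin s.
Proof.
elim: n s => //= n IH s; rewrite inE => /orP [/eqP ->|/IH].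
  exact: fresh_notin.
by rewrite inE negb_or => /andP [].
Qed.

Lemma freshes_uniq (n : nat) (s : seq V) : uniq (freshes F n s).
Proof.
elim: n s => //= n IH s; rewrite IH andbT.
by apply/negP => /freshes_notin; rewrite mem_head.
Qed.

End FreshVariables.

(** * Substitutions, valuations and satisfaction *)

(** The arguments of [TApp] sit inside a finite function, so the recursion is nested; a direct
    fixpoint supplies the hypothesis for each argument. *)
Lemma term_nested_ind (S : signature) (B V : Type) (R : term S B V -> Prop) :
  (forall x, R (TVar x)) -> (forall b, R (TVal b)) ->
  (forall n (c : dcons S n) (ts : {ffun 'I_n -> term S B V}),
      (forall i, R (ts i)) -> R (TApp c ts)) ->
  forall t, R t.
Proof.
move=> hvar hval happ; fix IH 1 => -[x|b|n c ts].
- exact: hvar.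
- exact: hval.
- apply: happ => i; exact: IH.
Qed.

Lemma bind_bind (S : signature) (B U V W : Type) (s : U -> term S B V)
    (s' : V -> term S B W) (t : term S B U) :
  bind s' (bind s t) = bind (fun x => bind s' (s x)) t.
Proof.
elim/term_nested_ind: t => //= n c ts IH.
by congr TApp; apply/ffunP => i; rewrite !ffunE.
Qed.

Lemma eq_in_bind (S : signature) (B V : Type) (U : eqType)
    (s s' : U -> term S B V) (t : term S B U) :
  {in tvars t, s =1 s'} -> bind s t = bind s' t.
Proof.
elim/term_nested_ind: t => [x h|//|n c ts IH h] /=.
  by apply: h; rewrite /= inE.
congr TApp; apply/ffunP => i; rewrite !ffunE; apply: IH => x hx; apply: h => /=.
by apply/flatten_mapP; exists i => //; rewrite mem_enum.
Qed.

Lemma bind_TVar (S : signature) (B : Type) (U : eqType) (t : term S B U) :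
  bind TVar t = t.
Proof.
elim/term_nested_ind: t => //= n c ts IH.
by congr TApp; apply/ffunP => i; rewrite !ffunE.
Qed.

Section Satisfaction.

Variables (S : signature) (C : cdomain S) (V : eqType).

Lemma bind_of_value (U : Type) (s : V -> term S (bval C) U) (v : value C) :
  bind s (of_value V v) = bind (fun x : void => match x with end) v.
Proof. by rewrite /of_value bind_bind; apply: eq_in_bind => -[]. Qed.

Lemma eval_of_value (eta : valuation C V) (v : value C) :
  bind eta (of_value V v) = v.
Proof.
by rewrite bind_of_value -[RHS]bind_TVar; apply: eq_in_bind => -[].
Qed.

Lemma eq_in_map_bind (U : Type) (s s' : V -> term S (bval C) U) (n : nat)
    (ts : n.-tuple (cterm C V)) :
  {in flatten [seq tvars t | t <- ts], s =1 s'} ->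
  map_tuple (bind s) ts = map_tuple (bind s') ts.
Proof.
move=> h; apply: val_inj; case: ts h => ts _ /=.
elim: ts => //= t ts IH h; congr cons.
  by apply: eq_in_bind => x hx; apply: h; rewrite mem_cat hx.
by apply: IH => x hx; apply: h; rewrite mem_cat hx orbT.
Qed.

Lemma eq_in_asat (eta eta' : valuation C V) (k : aconstr C V) :
  {in avars k, eta =1 eta'} -> asat eta k -> asat eta' k.
Proof.
case: k => [t u|n r ts] /= h; last by rewrite (eq_in_map_bind h).
rewrite (@eq_in_bind _ _ _ _ eta eta' t) ?(@eq_in_bind _ _ _ _ eta eta' u) //.
  by move=> x hx; apply: h; rewrite mem_cat hx orbT.
by move=> x hx; apply: h; rewrite mem_cat hx.
Qed.

Lemma eq_in_asubst (s s' : csubst C V) (k : aconstr C V) :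
  {in avars k, s =1 s'} -> asubst s k = asubst s' k.
Proof.
case: k => [t u|n r ts] /= h; last by rewrite (eq_in_map_bind h).
congr CEq; apply: eq_in_bind => x hx; apply: h; rewrite mem_cat hx ?orbT //.
Qed.

Lemma asat_asubst (eta : valuation C V) (s : csubst C V) (k : aconstr C V) :
  asat eta (asubst s k) <-> asat (fun x => bind eta (s x)) k.
Proof.
case: k => [t u|n r ts] /=; first by rewrite !bind_bind.
suff -> : map_tuple (bind eta) (map_tuple (bind s) ts) =
          map_tuple (bind (fun x => bind eta (s x))) ts by [].
apply: val_inj; rewrite /= -map_comp; apply: eq_map => t /=; exact: bind_bind.
Qed.

Lemma sat_conj (eta : valuation C V) (bs : seq (aconstr C V)) :
  sat eta (foldr (@CAnd S C V) CTrue [seq CAtom b | b <- bs]) <->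
  List.Forall (asat eta) bs.
Proof.
elim: bs => [|b bs IH] /=; first by split => // _; apply: List.Forall_nil.
by rewrite List.Forall_cons_iff IH.
Qed.

(** All existential witnesses are collected in one valuation. Repetitions in [us] do no harm,
    because only the values outside [us] are prescribed. *)
Lemma sat_exconstrP (eta : valuation C V) (us : seq V)
    (bs : seq (aconstr C V)) :
  sat eta (exconstr us bs) <->
  exists2 eta' : valuation C V, (forall x, x \notin us -> eta' x = eta x) &
    List.Forall (asat eta') bs.
Proof.
rewrite /exconstr; elim: us eta => [|u us IH] eta /=.
  rewrite sat_conj; split=> [h|[eta' heq]]; first by exists eta.
  apply: List.Forall_impl => b; apply: eq_in_asat => x _; exact: heq.
split=> [[v /IH [eta' heq h]]|[eta' heq h]].
  exists eta' => // x; rewrite inE negb_or => /andP [hxu hx].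
  by rewrite heq // (negbTE hxu).
exists (eta' u); apply/IH; exists eta' => // x hx.
by case: eqP => [->|/eqP hxu] //; apply: heq; rewrite inE negb_or hxu.
Qed.

Lemma sat_exconstr (eta : valuation C V) (us : seq V)
    (bs : seq (aconstr C V)) :
  List.Forall (asat eta) bs -> sat eta (exconstr us bs).
Proof. by move=> h; apply/sat_exconstrP; exists eta. Qed.

(** * Inversion of CHL derivations *)

Lemma chl_conP (P : program C V) (Pi : seq (constr C V)) (k : aconstr C V) :
  chl P Pi (ACon k) <-> entails Pi k.
Proof.
split; last by case: k => *; [apply: EA|apply: PA].
by move E : (ACon k) => A h; case: h E => // [t s h [->]|n r ts h [->]].
Qed.

Lemma Forall_chl_conP (P : program C V) (Pi : seq (constr C V))
    (theta : csubst C V) (bs : seq (aconstr C V)) :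
  List.Forall (fun A => chl P Pi (atsubst theta A)) [seq ACon b | b <- bs] <->
  List.Forall (fun b => entails Pi (asubst theta b)) bs.
Proof.
rewrite -[map _ _]/(List.map _ _) List.Forall_map.
by split; apply: List.Forall_impl => b /chl_conP.
Qed.

Lemma chl_def (P : program C V) (Pi : seq (constr C V)) (c : clause C V)
    (theta : csubst C V) (ts : (cl_ar c).-tuple (cterm C V)) :
  P c ->
  (forall i, entails Pi (CEq (tnth ts i) (bind theta (tnth (cl_args c) i)))) ->
  List.Forall (fun A => chl P Pi (atsubst theta A)) (cl_body c) ->
  chl P Pi (ADef (cl_pred c) ts).
Proof.
move=> hc hhead hbody; apply: (DA hc) => [i|]; first exact/chl_conP.
exact: (Forall_tnthP _ _).1 hbody.
Qed.

Lemma chl_def_inv (P : program C V) (Pi : seq (constr C V)) (n : nat)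
    (p : dpred S n) (ts : n.-tuple (cterm C V)) :
  chl P Pi (ADef p ts) ->
  exists args body theta,
    [/\ P (Clause p args body),
        forall i, entails Pi (CEq (tnth ts i) (bind theta (tnth args i)))
      & List.Forall (fun A => chl P Pi (atsubst theta A)) body].
Proof.
move E : (ADef p ts) => A h.
case: h E => // -[m q args body] theta us /= hc hhead hbody [e].
subst m => e1 e2.
have e3 := existT_nat_inj e1; have e4 := existT_nat_inj e2.
subst q ts.
exists args, body, theta; split => //.
  by move=> i; apply/chl_conP; apply: hhead.
exact/Forall_tnthP.
Qed.

End Satisfaction.

Section Elimination.

Variables (S : signature) (C : cdomain S) (V : eqType).
Variables (disp : Order.disp_t) (D : tbLatticeType disp) (Q : qualification D).
Variables (X : expressible C V Q) (F : var_supply V) (N : elim_preds S).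
Variables (P : qprogram C V D) (Pi : seq (constr C V)).

Local Notation P' := (elim_prog X F N P).
Local Notation "d <=_D e" := (Order.le (val d) (val e)) (at level 70).

Lemma eval_embt (eta : valuation C V) (d : nonbot D) :
  bind eta (embt X d) = emb X d.
Proof. exact: eval_of_value. Qed.

Lemma bind_embt (s : csubst C V) (d : nonbot D) :
  bind s (embt X d) = embt X d.
Proof. by rewrite /embt bind_of_value. Qed.

(** * The predicates qVal and qBound *)

(** The witnesses are values, hence ground terms that a substitution can insert. The instantiated
    constraints no longer depend on the valuation, so any [Pi] entails them. *)
Lemma chl_exconstr (eta : valuation C V) (us : seq V)
    (bs : seq (aconstr C V)) :
  sat eta (exconstr us bs) ->
  exists2 theta : csubst C V,
    (forall x, x \notin us -> theta x = of_value V (eta x)) &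
    List.Forall (fun A => chl P' Pi (atsubst theta A)) [seq ACon b | b <- bs].
Proof.
case/sat_exconstrP => eta' heq h; exists (fun x => of_value V (eta' x)).
  by move=> x hx; rewrite heq.
apply/Forall_chl_conP; apply: List.Forall_impl h => b hb eta0 _.
apply/asat_asubst; apply: eq_in_asat hb => x _.
by rewrite eval_of_value.
Qed.

Lemma chl_qval (d : nonbot D) : chl P' Pi (qval_at N (embt X d)).
Proof.
have hs := (qvalP X (fun=> emb X d)).2 (ex_intro _ d erefl).
have [theta htheta hbody] := chl_exconstr hs.
apply: (@chl_def _ _ _ _ _ (E_qVal X N) theta); first by left; left.
  by move=> i eta _; rewrite (ord1 i) /= htheta // qvX_notin.
exact: hbody.
Qed.

Lemma chl_qbound (x y z : nonbot D) :
  (val x <= att Q (val y) (val z))%O ->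
  chl P' Pi (qbound_at N (embt X x) (embt X y) (embt X z)).
Proof.
move=> hle.
(* The three parameters of qbound are pairwise distinct, so they can receive their values
   independently. *)
pose eta v := if v == qbX X then emb X x else
              if v == qbY X then emb X y else emb X z.
have := qb_uniq X; rewrite /= !inE negb_or andbT.
move=> /andP [/andP [hxy hxz] hyz].
have ex : eta (qbX X) = emb X x by rewrite /eta eqxx.
have ey : eta (qbY X) = emb X y by rewrite /eta eq_sym (negbTE hxy) eqxx.
have ez : eta (qbZ X) = emb X z.
  by rewrite /eta eq_sym (negbTE hxz) eq_sym (negbTE hyz).
have hs := (qboundP ex ey ez).2 hle.
have [theta htheta hbody] := chl_exconstr hs.
have := qb_notin X; rewrite /= !negb_or => /and4P [hX hY hZ _].
apply: (@chl_def _ _ _ _ _ (E_qBound X N) theta); first by left; right.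
  move=> i eta0 _.
  by case: i => [[|[|[|//]]] hi];
    rewrite !(tnth_nth (TVar (qvX X))) /= htheta // ?ex ?ey ?ez.
exact: hbody.
Qed.

Lemma Forall_entails_sat (eta : valuation C V) (theta : csubst C V)
    (us : seq V) (bs : seq (aconstr C V)) :
  sat_all eta Pi ->
  List.Forall (fun A => chl P' Pi (atsubst theta A)) [seq ACon b | b <- bs] ->
  sat (fun x => bind eta (theta x)) (exconstr us bs).
Proof.
move=> heta /Forall_chl_conP h; apply: sat_exconstr.
by apply: List.Forall_impl h => b /(_ eta heta) /asat_asubst.
Qed.

(** Only [E_qVal] can have been applied: [qBound] has another arity and primed symbols differ from
    [qVal]. Its instantiated body is entailed by [Pi], so evaluation at [eta] provides the witnesses
    of the existential constraint. *)
Lemma chl_qval_sat (eta : valuation C V) (t : cterm C V) :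
  sat_all eta Pi -> chl P' Pi (qval_at N t) ->
  exists d, bind eta t = emb X d.
Proof.
move=> heta /chl_def_inv [args [body [theta [hc hhead hbody]]]].
case: hc => [[|]|[[m q qargs alpha qbody] _]].
- move=> [e ebody]; have eargs := existT_nat_inj e; subst args body.
  have /= -> := hhead ord0 eta heta.
  apply: (qvalP X (fun x => bind eta (theta x))).1.
  exact: Forall_entails_sat.
- by [].
- rewrite /elim_clause /= => -[e]; subst m.
  by move=> e; have /esym/prime_of_qVal := existT_nat_inj e.
Qed.

Lemma chl_qbound_sat (eta : valuation C V) (t u v : cterm C V)
    (x y z : nonbot D) :
  sat_all eta Pi -> chl P' Pi (qbound_at N t u v) ->
  bind eta t = emb X x -> bind eta u = emb X y -> bind eta v = emb X z ->
  (val x <= att Q (val y) (val z))%O.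
Proof.
move=> heta /chl_def_inv [args [body [theta [hc hhead hbody]]]] hx hy hz.
case: hc => [[|]|[[m q qargs alpha qbody] _]].
- by [].
- move=> [e ebody]; have eargs := existT_nat_inj e; subst args body.
  have hi i := hhead i eta heta.
  have /= h0 := hi (Ordinal (isT : 0 < 3)).
  have /= h1 := hi (Ordinal (isT : 1 < 3)).
  have /= h2 := hi (Ordinal (isT : 2 < 3)).
  rewrite !(tnth_nth t) /= in h0 h1 h2.
  apply/(@qboundP _ _ _ _ _ _ X (fun w => bind eta (theta w))).
  + by rewrite -h0.
  + by rewrite -h1.
  + by rewrite -h2.
  + exact: Forall_entails_sat.
- rewrite /elim_clause /= => -[e]; subst m.
  by move=> e; have /esym/prime_of_qBound := existT_nat_inj e.
Qed.

(** * Translating derivations *)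

(** Generalises the first component of [elim_atom] from a variable to any term as extra argument, so
    that it is stable under substitution. *)
Definition prime_atom (A : atom C V) (t : cterm C V) : atom C V :=
  match A with
  | ADef n p ts => ADef (prime_of N p) [tuple of rcons ts t]
  | ACon k => ACon k
  end.

Lemma elim_atom_prime (A : atom C V) (W : V) :
  (elim_atom X N A W).1 = prime_atom A (TVar W).
Proof. by case: A. Qed.

Lemma atsubst_prime (theta : csubst C V) (A : atom C V) (t : cterm C V) :
  atsubst theta (prime_atom A t) =
  prime_atom (atsubst theta A) (bind theta t).
Proof. by case: A => //= n p ts; rewrite map_tuple_rcons. Qed.

Lemma eq_in_atsubst (s s' : csubst C V) (A : atom C V) :
  {in atvars A, s =1 s'} -> atsubst s A = atsubst s' A.
Proof.
case: A => [n p ts|k] /= h; first by rewrite (eq_in_map_bind h).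
by rewrite (eq_in_asubst h).
Qed.

Lemma att_lel (d e : D) : (att Q d e <= d)%O.
Proof. by rewrite attC att_le. Qed.

Lemma att_topl (d : D) : att Q \top%O d = d.
Proof. by rewrite attC att_top. Qed.

(** Distributivity handles nonempty meets. The bound by [a] covers the empty meet, which is top and
    attenuates to [a] itself. *)
Lemma le_att_meets (n : nat) (d a : D) (e : 'I_n -> D) :
  (d <= a)%O -> (forall j, d <= att Q a (e j))%O ->
  (d <= att Q a (\meet_(j < n) e j))%O.
Proof.
move=> hda he; apply: (big_ind (fun m => d <= att Q a m)%O) => //.
  by rewrite att_top.
by move=> x y hx hy; rewrite att_meet lexI hx.
Qed.

Lemma le_qtop (d : nonbot D) : d <=_D qtop Q.
Proof. exact: lex1. Qed.

Lemma above_qtop (w : threshold D) : above (qtop Q) w.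
Proof. by case: w => //= w; exact: lex1. Qed.

Lemma qchl_conP (k : aconstr C V) (d : nonbot D) :
  qchl Q P Pi (ACon k) d <-> entails Pi k.
Proof.
split; last by case: k => *; [apply: QEA|apply: QPA].
by move E : (ACon k) => A h; case: h E => // [t s ? h [->]|n r ts ? h [->]].
Qed.

(** The last rule alone decides: QDA bounds its conclusion only from above, and QEA and QPA allow
    every qualification. *)
Lemma qchl_le (A : atom C V) (d e : nonbot D) :
  d <=_D e -> qchl Q P Pi A e -> qchl Q P Pi A d.
Proof.
move=> hle h; move: hle.
case: h => [c theta ts ds es d0 hc h1 h2 h3 h4|t s ? h|n r ts ? h] hle.
- by apply: (QDA hc h1 h2 h3); apply: le_trans hle h4.
- exact: QEA.
- exact: QPA.
Qed.

Lemma atsubst_qval (theta : csubst C V) (t : cterm C V) :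
  atsubst theta (qval_at N t) = qval_at N (bind theta t).
Proof. by congr ADef; apply: val_inj. Qed.

Lemma atsubst_qbound (theta : csubst C V) (t u v : cterm C V) :
  atsubst theta (qbound_at N t u v) =
  qbound_at N (bind theta t) (bind theta u) (bind theta v).
Proof. by congr ADef; apply: val_inj. Qed.

Lemma chl_elim_bound (theta : csubst C V) (t : cterm C V) (e : nonbot D)
    (w : threshold D) :
  bind theta t = embt X e -> above e w ->
  List.Forall (fun A => chl P' Pi (atsubst theta A)) (elim_bound X N t w).
Proof.
move=> ht; case: w => [w|] /= hw; last exact: List.Forall_nil.
apply: List.Forall_cons; last exact: List.Forall_nil.
rewrite atsubst_qbound !bind_embt ht.
by apply: chl_qbound; rewrite att_topl.
Qed.

Lemma elim_bound_above (eta : valuation C V) (theta : csubst C V)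
    (t : cterm C V) (e : nonbot D) (w : threshold D) :
  sat_all eta Pi -> bind eta (bind theta t) = emb X e ->
  List.Forall (fun A => chl P' Pi (atsubst theta A)) (elim_bound X N t w) ->
  above e w.
Proof.
move=> heta ht; case: w => [w|] //= /List.Forall_cons_iff [+ _].
rewrite atsubst_qbound !bind_embt => h.
have := chl_qbound_sat heta h (eval_embt _ _) (eval_embt _ _) ht.
by rewrite att_topl.
Qed.

(* The qualification term of a constraint atom is the constant for top, not the
   variable [W]; the value [e] attached to [W] is then replaced by top. *)
Lemma elim_atom_term (theta : csubst C V) (A : atom C V) (W : V)
    (e : nonbot D) :
  theta W = embt X e ->
  exists e', [/\ bind theta (elim_atom X N A W).2 = embt X e', e <=_D e' &
    forall w : threshold D, above e w -> above e' w].
Proof.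
case: A => [n p ts|k] /= hW; first by exists e.
exists (qtop Q); rewrite bind_embt le_qtop.
by split => // w _; apply: above_qtop.
Qed.

Lemma qcl_vars_head (c : qclause C V D) (i : 'I_(qcl_ar c)) :
  {subset tvars (tnth (qcl_args c) i) <= qcl_vars c}.
Proof.
move=> x hx; rewrite mem_cat; apply/orP; left.
case: c i hx => n p args a b i /=.
have -> : tvars (tnth args i) = nth [::] [seq tvars t | t <- args] i.
  rewrite (tnth_nth (tnth args i)) (nth_map (tnth args i)) // size_tuple.
  exact: ltn_ord.
move=> hx; apply/flattenP; exists (nth [::] [seq tvars t | t <- args] i) => //.
by rewrite mem_nth // size_map size_tuple.
Qed.

Lemma mem_flatten_tnth (T : Type) (f : T -> seq V) (s : seq T)
    (j : 'I_(size s)) :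
  {subset f (tnth (in_tuple s) j) <= flatten [seq f y | y <- s]}.
Proof.
move=> x hx; apply/flattenP; exists (f (tnth (in_tuple s) j)) => //.
rewrite (tnth_nth (tnth (in_tuple s) j)) /=.
by rewrite -(nth_map _ [::]) // mem_nth // size_map.
Qed.

Lemma qcl_vars_body (c : qclause C V D) (j : 'I_(size (qcl_body c))) :
  {subset atvars (tnth (in_tuple (qcl_body c)) j).1 <= qcl_vars c}.
Proof.
move=> x hx; rewrite mem_cat; apply/orP; right.
by apply: (@mem_flatten_tnth _ (fun B : atom C V * threshold D => atvars B.1))
  hx.
Qed.

(** The substitution used by QDA is extended to the fresh variables: [W] receives the qualification
    of the head, the [j]-th variable of [Ws] that of the [j]-th body atom. Freshness leaves the
    instance of the original clause unchanged. *)
Lemma qchl_chl (A : atom C V) (d : nonbot D) :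
  qchl Q P Pi A d -> chl P' Pi (prime_atom A (embt X d)).
Proof.
elim=> {A d} [c theta ts ds es d hc hhead _ _ IHbody habove hd
  |t s d h|n r ts d h]; [|exact: EA|exact: PA].
pose W := fresh F (qcl_vars c).
pose Ws := freshes F (size (qcl_body c)) (W :: qcl_vars c).
have sizeWs : size Ws = size (qcl_body c) by apply: size_freshes.
(* The position of a variable in [Ws] tells which body atom it belongs to; top is a filler for
   variables outside [Ws]. *)
pose e x := if insub (index x Ws) is Some j then es j else qtop Q.
pose theta' x := if x \in qcl_vars c then theta x else
                 if x == W then embt X d else embt X (e x).
have theta'_vars x : x \in qcl_vars c -> theta' x = theta x.
  by rewrite /theta' => ->.
have theta'_W : theta' W = embt X d.
  by rewrite /theta' (negbTE (fresh_notin F _)) eqxx.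
have theta'_Ws (j : 'I_(size (qcl_body c))) :
    theta' (nth W Ws j) = embt X (es j).
  have hj : nth W Ws j \in Ws by rewrite mem_nth // sizeWs.
  have := freshes_notin hj; rewrite inE negb_or => /andP [h1 h2].
  rewrite /theta' (negbTE h1) (negbTE h2) /e.
  rewrite index_uniq ?sizeWs ?freshes_uniq // valK //.
move: hd; rewrite lexI => /andP [_ hd].
(* The single inequality of QDA on the meet splits by monotonicity into one inequality per body
   atom, which is what the [qBound] atoms express. *)
have hde j : (val d <= att Q (val (qcl_att c)) (val (es j)))%O.
  by apply: le_trans hd _; apply: att_mono => //; apply: meets_inf.
have /= := @chl_def _ _ _ P' Pi (elim_clause X F N c) theta'
  [tuple of rcons ts (embt X d)]; apply.
- by right; exists c.
- apply: (@tnth_rconsP _ _ (fun t u => entails Pi (CEq t (bind theta' u)))).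
    move=> i; rewrite (@eq_in_bind _ _ _ _ theta' theta).
      by apply/(qchl_conP _ (ds i)); apply: hhead.
    by move=> x /qcl_vars_head; apply: theta'_vars.
  by move=> eta _ /=; rewrite theta'_W.
- apply: List.Forall_cons.
    by rewrite atsubst_qval /= theta'_W; apply: chl_qval.
  apply/(Forall_flatten_zip _ _ W sizeWs) => j.
  have := IHbody j; have := habove j; have := @qcl_vars_body c j.
  case: (tnth _ j) => B w /= hB hw IHB.
  have [e' [he' hle hab]] := elim_atom_term B (theta'_Ws j).
  have := elim_atom_prime B (nth W Ws j).
  case: elim_atom he' => B' w' /= hw' ->.
  apply: List.Forall_cons; first by rewrite atsubst_qval hw'; apply: chl_qval.
  apply/Forall_cat; split; first exact: chl_elim_bound hw' (hab _ hw).
  apply: List.Forall_cons.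
    rewrite atsubst_qbound hw' bind_embt /= theta'_W.
    by apply/chl_qbound/(le_trans (hde j)); apply: att_mono.
  apply: List.Forall_cons; last exact: List.Forall_nil.
  rewrite atsubst_prime /= theta'_Ws (@eq_in_atsubst theta' theta) //.
  by move=> x /hB; apply: theta'_vars.
Qed.

(** * From CHL derivations back to QCHL derivations *)

Hypothesis att_facts :
  forall c, P c -> qcl_body c = [::] -> qcl_att c = qtop Q.

(** For a defined atom, the qualification supplied by the premise and the [e] read off at [eta] have
    the same image under [emb], so injectivity identifies them. For a constraint, every [e] is
    derivable. *)
Lemma qchl_elim_atom (eta : valuation C V) (theta : csubst C V)
    (A : atom C V) (W : V) (e : nonbot D) :
  (forall n (p : dpred S n) (ts : n.-tuple (cterm C V)) (t : cterm C V),
     atsubst theta (elim_atom X N A W).1 =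
       ADef (prime_of N p) [tuple of rcons ts t] ->
     exists2 d, bind eta t = emb X d & qchl Q P Pi (ADef p ts) d) ->
  chl P' Pi (atsubst theta (elim_atom X N A W).1) ->
  bind eta (bind theta (elim_atom X N A W).2) = emb X e ->
  qchl Q P Pi (atsubst theta A) e.
Proof.
case: A => [n p ts|k] /= h; last by move=> /chl_conP h1 _; apply/qchl_conP.
move=> _ he; rewrite map_tuple_rcons in h.
have [d hd] := h _ _ _ _ erefl.
by suff -> : d = e by []; apply: (@emb_inj _ _ _ _ _ _ X); rewrite -hd.
Qed.

(** Since [eta] is fixed before the induction, the qualifications read off in all subderivations
    refer to the same valuation and can be compared. The shape of [A] is given by an equation
    because the induction also passes through [qVal], [qBound] and constraint atoms. *)
Lemma chl_qchl (eta : valuation C V) (heta : sat_all eta Pi) (A : atom C V) :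
  chl P' Pi A ->
  forall n (p : dpred S n) (ts : n.-tuple (cterm C V)) (t : cterm C V),
  A = ADef (prime_of N p) [tuple of rcons ts t] ->
  exists2 d, bind eta t = emb X d & qchl Q P Pi (ADef p ts) d.
Proof.
elim=> {A} [c' theta us hc' hhead _ hbody IHbody|//|//] n p ts t.
case: hc' => [[|] ec|[[m q args alpha body] hc ec]]; subst c'.
- move=> [e]; subst n => e _; by have /esym/prime_of_qVal := existT_nat_inj e.
- move=> [e]; subst n => e _; by have /esym/prime_of_qBound := existT_nat_inj e.
move: us hhead hbody IHbody => /=.
set c := QClause q args alpha body in hc *.
set W := fresh F (qcl_vars c).
set Ws := freshes F (size body) (W :: qcl_vars c).
have sizeWs : size Ws = size body by apply: size_freshes.
clearbody W Ws.
set body' := (_ :: _) => us hhead hbody IHbody [e]; subst m => e1 e2.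
have {e2} eus := existT_nat_inj e2; subst us.
have {e1} /prime_of_inj epq := existT_nat_inj e1; subst q.
have {}hhead i := (chl_conP _ _ _).1 (hhead i).
(* Derivability and induction hypothesis are paired, so that one decomposition into blocks serves
   both. *)
have {hbody IHbody} : List.Forall (fun A => chl P' Pi (atsubst theta A) /\
    forall n (p : dpred S n) (ts : n.-tuple (cterm C V)) (t : cterm C V),
    atsubst theta A = ADef (prime_of N p) [tuple of rcons ts t] ->
    exists2 d, bind eta t = emb X d & qchl Q P Pi (ADef p ts) d) body'.
  by apply/Forall_tnthP => j; split; [apply: hbody|apply: IHbody].
move=> /List.Forall_cons_iff [[+ _] hb].
rewrite atsubst_qval => /(chl_qval_sat heta) [d hd].
have {}hb := (Forall_flatten_zip _ _ W sizeWs).1 hb.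
have /fin_all_exists [es hes] : forall j : 'I_(size body), exists ej,
    [/\ qchl Q P Pi (atsubst theta (tnth (in_tuple body) j).1) ej,
        above ej (tnth (in_tuple body) j).2 &
        (val d <= att Q (val alpha) (val ej))%O].
  move=> j; have {hb} := hb j; case: (tnth _ j) => B w /=.
  have := @qchl_elim_atom eta theta B (nth W Ws j).
  case: elim_atom => B' w' /= hB.
  case/List.Forall_cons_iff => -[+ _] /Forall_cat [hbnd].
  rewrite atsubst_qval => /(chl_qval_sat heta) [ej hej].
  case/List.Forall_cons_iff => -[hq _] /List.Forall_cons_iff [[h1 h2] _].
  exists ej; split; first exact: hB.
    apply: elim_bound_above heta hej _.
    by apply: List.Forall_impl hbnd => ? [].
  move: hq; rewrite atsubst_qbound bind_embt => hq.
  exact: chl_qbound_sat heta hq hd (eval_embt _ _) hej.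
(* With a nonempty body, any one [qBound] atom gives this, as attenuation lies below its first
   argument. With an empty body no such atom exists, and [alpha] is top by [att_facts]. *)
have hda : (val d <= val alpha)%O.
  case eb : (size body) => [|k].
    by rewrite -[alpha]/(qcl_att c) (att_facts hc (size0nil eb)) le_qtop.
  have hk : 0 < size body by rewrite eb.
  by have [_ _ /le_trans] := hes (Ordinal hk); apply; apply: att_lel.
exists d.
  by have /= := hhead ord_max eta heta; rewrite !tnth_rcons_ord_max => ->.
(* The head equations may carry any qualification; choosing top makes their meet impose no bound on
   [d]. *)
apply: (@QDA _ _ _ _ _ _ _ _ c theta ts (fun=> qtop Q) es d hc) => /=.
- move=> i; apply/qchl_conP.
  by have := hhead (widen_ord (leqnSn n) i); rewrite !tnth_rcons_widen.
- by move=> j; have [] := hes j.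
- by move=> j; have [] := hes j.
rewrite lexI le_att_meets ?andbT //; last by move=> j; have [] := hes j.
by apply/meetsP => i _; exact: le_qtop.
Qed.

End Elimination.

(** * Solutions of goals *)

Theorem theorem4p4
    (S : signature) (C : cdomain S) (V : eqType)
    (disp : Order.disp_t) (D : tbLatticeType disp) (Q : qualification D)
    (X : expressible C V Q) (F : var_supply V) (N : elim_preds S)
    (P : qprogram C V D) (G : qgoal C V D)
    (hG : qgoal_wf G)
    (* Vacuous when every body is nonempty.  The transformed clause of a fact
       p(ts) <-alpha- is p'(ts, W) <- qVal(W), which does not bound W by alpha,
       so the equivalence fails for facts with alpha <> top. *)
    (hfacts : forall c, P c -> qcl_body c = [::] -> qcl_att c = qtop Q)
    (hPval : qprog_no_pred (qVal N) P) (hPbound : qprog_no_pred (qBound N) P)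
    (hGval : qgoal_no_pred (qVal N) G) (hGbound : qgoal_no_pred (qBound N) G)
    (sigma : csubst C V) (mu : {x : V | x \in war G} -> nonbot D)
    (Pi : seq (constr C V)) (hPi : satisfiable Pi) :
  let P' := elim_prog X F N P in
  let G' := elim_goal X F N G in
  qSol Q P sigma mu Pi <->
  exists theta : csubst C V,
    [/\ Sol P' G' theta Pi,
        (forall x, x \in qgvars G -> theta x = sigma x),
        (forall W : {x : V | x \in war G}, theta (val W) = embt X (mu W))
      & (forall W, W \in gvars G' -> W \notin qgvars G -> W \notin war G ->
           exists d : nonbot D, theta W = embt X d)].
Proof.
move=> P' G'; rewrite /qSol.
set Ws := freshes F (size G) (qgvars G ++ war G).
have sizeWs : size Ws = size G by apply: size_freshes.
have mem_war (j : 'I_(size G)) : qg_war (tnth (in_tuple G) j) \in war G.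
  set g := tnth _ _; rewrite /g (tnth_nth g) -(nth_map _ (qg_war g)) //.
  by rewrite mem_nth // size_map.
pose Wj j : {x | x \in war G} := exist (fun x => x \in war G) _ (mem_war j).
have qgvars_j j := @mem_flatten_tnth _ _ (fun g => atvars (qg_atom g)) G j.
split.
  move=> hsol.
  have hab j := (hsol j (Wj j) erefl).1.
  have hq j := (hsol j (Wj j) erefl).2.
  (* The fresh variable of the [j]-th atom receives the same qualification as [W_j], so
     [qBound(W_j, top, w'_j)] holds with equality for a defined atom. For a constraint atom, [w'_j]
     is top. *)
  pose f x := if insub x is Some W then mu W else
    if insub (index x Ws) is Some j then mu (Wj j) else qtop Q.
  pose theta x := if x \in qgvars G then sigma x else embt X (f x).
  have theta_war W : theta (val W) = embt X (mu W).
    (* Well-formedness keeps [W] out of the variables of the atoms, where [theta] would follow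
       [sigma] instead. *)
    have /hasPn/(_ _ (valP W)) /= hW := hG.
    by rewrite /theta (negbTE hW) /f valK.
  have theta_Ws (j : 'I_(size G)) x0 : theta (nth x0 Ws j) = embt X (mu (Wj j)).
    have hj : nth x0 Ws j \in Ws by rewrite mem_nth // sizeWs.
    have := freshes_notin hj; rewrite mem_cat negb_or => /andP [h1 h2].
    rewrite /theta (negbTE h1) /f insubN //.
    by rewrite index_uniq ?sizeWs ?freshes_uniq // valK.
  exists theta; split=> [|x|//|W _ h _].
  - split=> //; apply/(Forall_tnthP (fun A => chl P' Pi (atsubst theta A))).
    (* [nth] needs a default variable; a nonempty goal provides one, and for the empty goal there is
       nothing to derive. *)
    case eG : (size G) => [|k].
      by rewrite /G' /elim_goal (size0nil eG).
    have x0 : V by case: (G) eG => // g _ _; exact: qg_war g.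
    apply/(Forall_flatten_zip _ _ x0 sizeWs) => j.
    have := hab j; have := hq j; have := theta_war (Wj j).
    have := qgvars_j j; rewrite /=.
    case: (tnth _ j) (theta_Ws j x0) => B W beta /= hWs hB hW hqB hbeta.
    have [e [he hle _]] := elim_atom_term N B hWs.
    have := elim_atom_prime X N B (nth x0 Ws j).
    case: elim_atom he => B' w' /= hw' ->.
    apply: List.Forall_cons.
      by rewrite atsubst_qval /= hW; apply: chl_qval.
    apply/Forall_cat; split; first by apply: chl_elim_bound hbeta.
    apply: List.Forall_cons; first by rewrite atsubst_qval hw'; apply: chl_qval.
    apply: List.Forall_cons.
      rewrite atsubst_qbound hw' bind_embt /= hW.
      by apply: chl_qbound; rewrite att_topl.
    apply: List.Forall_cons; last exact: List.Forall_nil.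
    rewrite atsubst_prime /= hWs (@eq_in_atsubst _ _ _ theta sigma).
      exact: qchl_chl.
    by move=> x /hB; rewrite /theta => ->.
  - by rewrite /theta => ->.
  - by exists (f W); rewrite /theta (negbTE h).
move=> [theta [[_ hsol] theta_vars theta_war _]] j W hW.
(* Satisfiability of [Pi] provides the valuation at which all qualifications are read. *)
have [eta heta] := hPi.
have hsolF := (Forall_tnthP (fun A => chl P' Pi (atsubst theta A)) _).2 hsol.
have := (Forall_flatten_zip _ _ (val W) sizeWs).1 hsolF j.
have := theta_war W; rewrite hW; have := qgvars_j j.
case: (tnth _ j) => B W' beta /= hB hW'.
have := @qchl_elim_atom _ _ _ _ _ _ X F N P Pi eta theta B (nth W' Ws j).
case: elim_atom => B' w' /= hqB.
case/List.Forall_cons_iff => _ /Forall_cat [hbnd].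
case/List.Forall_cons_iff => + /List.Forall_cons_iff.
move=> + [+ /List.Forall_cons_iff [hB' _]].
rewrite atsubst_qval atsubst_qbound bind_embt /= hW'.
move=> /(chl_qval_sat heta) [e he] hle.
have := chl_qbound_sat heta hle (eval_embt _ _ _) (eval_embt _ _ _) he.
rewrite att_topl => {}hle; split.
  by apply: elim_bound_above heta _ hbnd; rewrite /= hW' eval_embt.
(* The derivation is obtained for the value [e] of [w'_j] at [eta], then weakened to [mu W], which
   the [qBound] atom of the goal places below [e]. *)
apply: qchl_le hle _.
rewrite (@eq_in_atsubst _ _ _ sigma theta); last by move=> x /hB/theta_vars.
exact: hqB (chl_qchl hfacts heta hB') hB' he.
Qed.
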